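(* For every integer $n\ge 3$, the leaf rank of $R_n$ is at least $2^{n-2}$.
   Context: For $n\ge 3$, $R_n$ is the graph with vertex set $\bigcup_{i=1}^n\{a_i,b_i,c_i,d_i\}$ (all distinct, $4n$ vertices), in which two distinct vertices are adjacent iff they both belong to one of the sets $C_i=\{a_i,b_i,c_i,d_i\}$ ($1\le i\le n$) or $C'_i=\{a_j\mid i\le j\le n\}\cup\{b_i,b_{i+1},c_i\}$ ($1\le i\le n-1$). For a positive integer $k$, a graph $G$ is a $k$-leaf power if there is a tree $T$ and a bijection $\tau$ from $V(G)$ to the leaves of $T$ such that distinct $u,v$ are adjacent in $G$ iff $\tau(u),\tau(v)$ have distance at most $k$ in $T$. The leaf rank of $G$ is the smallest $k$ such that $G$ is a $k$-leaf power ($\infty$ if none exists). *)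

(* Defs.v *)
From mathcomp Require Import all_boot.
Set Implicit Arguments. Unset Strict Implicit. Unset Printing Implicit Defensive.

Definition simple_graph (T : finType) (e : rel T) : Prop :=
  symmetric e /\ irreflexive e.

Definition dist_le (T : finType) (e : rel T) (x y : T) (k : nat) : Prop :=
  exists p : seq T, size p <= k /\ path e x p /\ last x p = y.

Definition connected_graph (T : finType) (e : rel T) : Prop :=
  forall x y : T, exists p : seq T, path e x p /\ last x p = y.

Definition acyclic (T : finType) (e : rel T) : Prop :=
  forall (x : T) (p : seq T),
    ~ [/\ uniq (x :: p), 2 <= size p, path e x p & e (last x p) x].

Definition is_tree (T : finType) (e : rel T) : Prop :=
  [/\ simple_graph e, 0 < #|T|, connected_graph e & acyclic e].

Definition leaf (T : finType) (e : rel T) (t : T) : bool :=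
  #|[set u | e t u]| == 1.

Definition k_leaf_power (V : finType) (adj : rel V) (k : nat) : Prop :=
  exists (T : finType) (e : rel T) (tau : V -> T),
    [/\ is_tree e,
        injective tau,
        (forall v, leaf e (tau v)),
        (forall t, leaf e t -> exists v, tau v = t) &
        (forall u v, u != v -> (adj u v <-> dist_le e (tau u) (tau v) k))].

(* Vertex (i, l) : 'I_n * 'I_4 stands for a_{i+1}, b_{i+1}, c_{i+1}, d_{i+1}
   according to l = 0, 1, 2, 3 (indices shifted to start at 0). *)

(* membership in C'_{i+1} = {a_j | i <= j} U {b_i, b_{i+1}, c_i} (0-indexed) *)
Definition inCp (n : nat) (i : nat) (v : 'I_n * 'I_4) : bool :=
  let j := nat_of_ord v.1 in
  let l := nat_of_ord v.2 in
  [|| (l == 0) && (i <= j),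
      (l == 1) && ((j == i) || (j == i.+1)) |
      (l == 2) && (j == i)].

Definition R_adj (n : nat) : rel ('I_n * 'I_4) :=
  fun u v =>
    (u != v) &&
    ((u.1 == v.1) ||
     [exists i : 'I_n, [&& (i < n - 1), inCp i u & inCp i v]]).

(* Main.v *)
(* Let d be the distance in the tree between the images of the vertices,
   numbered from 0.  For 0 < j < n - 1, let q_j be the point where the path from
   a_0 enters the subtree spanned by c_j, d_j and b_{j+1}.  It lies on the path
   from c_j to a neighbour of c_j, and a_{j-1} is adjacent to neither end, so
   d(a_{j-1}, q_j) >= k/2 + 1.  On the other hand d(a_0, q_j) + d(q_j, a_j) <= k:
   this is the adjacency of a_0 and a_j if q_j separates them, and otherwise a_j
   is closer to q_j than a_{j+1} is, because of d_j.  As q_j lies between a_0 and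
   q_{j+1}, the excess x_j = 2 d(a_0, q_j) - k satisfies
   x_{j+1} >= 2 x_j + 2, while x_{n-2} <= k. *)

Require Import Defs.
From mathcomp Require Import all_boot.
From mathcomp Require Import zify.

Set Implicit Arguments. Unset Strict Implicit. Unset Printing Implicit Defensive.

(** * Distances in a finite tree *)

Definition between (T : Type) (d : T -> T -> nat) (x m y : T) : Prop :=
  d x m + d m y = d x y.

(** The four-point condition alone admits three points at mutual distance 1; [tm_median] excludes
    them and supplies the branching points. *)
Record tree_metric (T : Type) (d : T -> T -> nat) : Prop := TreeMetric {
  tm_refl : forall x, d x x = 0;
  tm_sym : forall x y, d x y = d y x;
  tm_triangle : forall x y z, d x z <= d x y + d y z;
  tm_four_point : forall x y z w,
    d x y + d z w <= maxn (d x z + d y w) (d x w + d y z);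
  tm_median : forall x y z, exists m,
    [/\ between d x m y, between d x m z & between d y m z] }.

Lemma graph_distance_exists (T : finType) (e : rel T) :
  symmetric e -> connected_graph e ->
  exists d : T -> T -> nat,
    [/\ forall x y k, dist_le e x y k <-> d x y <= k,
        forall x y, (d x y == 0) = (x == y),
        forall x y, d x y = d y x,
        forall x y z, d x z <= d x y + d y z &
        forall x y, x != y -> exists2 u, e x u & d x y = (d u y).+1].
Proof.
move=> esym econ.
pose P x y n := [exists p : n.-tuple T, path e x p && (last x p == y)].
have exP x y : exists n, P x y n.
  have [p [ep lp]] := econ x y.
  by exists (size p); apply/existsP; exists (in_tuple p); rewrite ep lp eqxx.
pose d x y := ex_minn (exP x y).
have d_le x y p : path e x p -> last x p = y -> d x y <= size p.
  move=> ep lp; rewrite /d; case: ex_minnP => m _; apply.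
  by apply/existsP; exists (in_tuple p); rewrite ep lp eqxx.
have d_geo x y : exists p, [/\ path e x p, last x p = y & size p = d x y].
  rewrite /d; case: ex_minnP => m /existsP[p /andP[ep /eqP lp]] _.
  by exists p; rewrite size_tuple.
have d_tri x y z : d x z <= d x y + d y z.
  have [p [ep lp <-]] := d_geo x y; have [q [eq lq <-]] := d_geo y z.
  by rewrite -size_cat; apply: d_le; rewrite ?cat_path ?last_cat lp ?ep.
have d_symle x y : d y x <= d x y.
  have [p [ep lp <-]] := d_geo x y.
  rewrite -[size p](size_belast x) -size_rev; apply: d_le.
    rewrite -lp rev_path; apply: sub_path ep => u v /=.
    by rewrite esym.
  by rewrite -lp; case: (p) => //= a s; rewrite rev_cons last_rcons.
exists d; split=> //.
- move=> x y k; split=> [[p [sp [ep lp]]]|dk].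
    exact: leq_trans (d_le _ _ _ ep lp) sp.
  by have [p [ep lp sp]] := d_geo x y; exists p; rewrite sp.
- move=> x y; apply/eqP/eqP => [dxy|<-].
    by have [p [_ lp]] := d_geo x y; rewrite dxy => /size0nil p0; rewrite -lp p0.
  by apply/eqP; rewrite -leqn0; apply: (d_le x x [::]).
- by move=> x y; apply/eqP; rewrite eqn_leq !d_symle.
move=> x y xy; have [[|u p] [ep lp sp]] := d_geo x y.
  by rewrite -lp eqxx in xy.
case/andP: ep => exu ep; exists u => //; apply/eqP; rewrite eqn_leq.
rewrite -{2}sp ltnS (d_le _ _ _ ep lp) // andbT.
rewrite (leq_trans (d_tri _ u _)) //.
by have := d_le x u [:: u]; rewrite /= exu => /(_ erefl erefl); lia.
Qed.

Definition avoiding (T : finType) (e : rel T) (m : T) : rel T :=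
  [rel x y | [&& e x y, x != m & y != m]].

(** If [u] and [v] differed, a simple path joining them outside [m] would close up through [m] to a
    cycle. *)
Lemma neighbours_separated (T : finType) (e : rel T) (m u v : T) :
  symmetric e -> irreflexive e -> acyclic e -> e m u -> e m v ->
  connect (avoiding e m) u v -> u = v.
Proof.
move=> esym eirr eac emu emv /connectP[p]; case/shortenP=> q qp uq _ lq.
apply/eqP/negPn/negP => uv; apply: (eac m (u :: q)); split.
- rewrite cons_uniq uq andbT inE negb_or; apply/andP; split.
    by apply: contraTneq emu => <-; rewrite eirr.
  apply/negP => mq; move: qp; case/splitPr: mq => q1 q2.
  by rewrite cat_path /= => /and3P[_ /and3P[_ _ /eqP]].
- by case: q lq {uq qp} => // vu; rewrite vu eqxx in uv.
- by rewrite /= emu; apply: sub_path qp => x y /and3P[].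
- by rewrite /= -lq esym.
Qed.

Lemma tree_distance (T : finType) (e : rel T) : is_tree e ->
  exists2 d : T -> T -> nat, tree_metric d &
    forall x y k, dist_le e x y k <-> d x y <= k.
Proof.
case=> -[esym eirr] _ econ eac.
have [d [d_le d0 d_sym d_tri d_step]] := graph_distance_exists esym econ.
exists d => //.
have d_edge x y : e x y -> d x y <= 1.
  by move=> exy; apply/d_le; exists [:: y]; rewrite /= exy.
have dxx x : d x x = 0 by apply/eqP; rewrite d0.
have av_sym m : connect_sym (avoiding e m).
  by apply: sym_connect_sym => x y; rewrite /avoiding /= esym; congr (_ && _); rewrite andbC.
(* A shortest path strictly shorter than every detour through [m] never meets [m]. *)
have geo m x y : d x y < d x m + d m y -> connect (avoiding e m) x y.
  have [k le_k] := ubnP (d x y); elim: k => // k IH in x le_k * => lt_m.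
  have [<-|/d_step[u exu dxy]] := eqVneq x y; first exact: connect0.
  have := d_edge _ _ exu; have := d_tri x u m => dxm dxu.
  have xm : x != m by apply: contraTneq lt_m => ->; rewrite dxx ltnn.
  have lt_u : d u y < d u m + d m y by lia.
  have um : u != m by apply: contraTneq lt_u => ->; rewrite dxx ltnn.
  apply: connect_trans (IH u _ lt_u); last by lia.
  by apply: connect1; rewrite /avoiding /= exu xm um.
(* Otherwise [z] shares a component outside [m] with both [x] and [y]. The steps from [m] towards
   [x] and [y] then coincide, giving a shortcut from [x] to [y]. *)
have sep x m y z : between d x m y -> between d x m z \/ between d y m z.
  rewrite /between => xmy.
  have [|nx] := eqVneq (d x m + d m z) (d x z); first by left.
  have [|ny] := eqVneq (d y m + d m z) (d y z); first by right.
  have := d_tri x m z; have := d_tri y m z => ty tx.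
  have mx : m != x by apply: contraNneq nx => <-; rewrite dxx.
  have my : m != y by apply: contraNneq ny => <-; rewrite dxx.
  have [u emu du] := d_step _ _ mx; have [v emv dv] := d_step _ _ my.
  have := d_tri x u y; rewrite (d_sym x u) => tu.
  suff uv : u = v by have := d_sym x m; rewrite uv in du tu; lia.
  apply: (neighbours_separated esym eirr eac emu emv).
  apply: (connect_trans (geo m u x _)); first by lia.
  apply: (connect_trans (geo m x z _)); first by lia.
  apply: (@connect_trans _ _ y); rewrite av_sym; apply: geo; last by lia.
  by lia.
have med x y z : exists m,
    [/\ between d x m y, between d x m z & between d y m z].
  have bx : d x x + d x y == d x y by rewrite dxx.
  (* The median is the point of the path from [x] to [y] nearest to [z]. *)
  have [m /eqP xmy minm] := @arg_minnP _ x (fun m => d x m + d m y == d x y)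
                                        (fun m => d z m) bx.
  (* Otherwise the step from [m] towards [w] is also a step towards [z]. *)
  have half w w' : d w m + d m w' = d w w' ->
      (forall u, d w u + d u w' = d w w' -> d z m <= d z u) ->
      between d w m z.
    rewrite /between => wmw' min_m.
    apply/eqP; apply/negPn/negP => nw; have tw := d_tri w m z.
    have mw : m != w by apply: contraNneq nw => <-; rewrite dxx.
    have mz : m != z by apply: contraNneq nw => <-; rewrite dxx addn0.
    have [u emu du] := d_step _ _ mw; have [v emv dv] := d_step _ _ mz.
    have uv : u = v.
      apply: (neighbours_separated esym eirr eac emu emv).
      apply: (connect_trans (geo m u w _)); first by lia.
      apply: (connect_trans (geo m w z _)); first by lia.
      by rewrite av_sym; apply: geo; lia.
    have /min_m : d w u + d u w' = d w w'.
      have := d_tri w u w'; have := d_tri u m w'; have := d_edge _ _ emu.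
      rewrite (d_sym m u) (d_sym w u); move: (d_sym w m); lia.
    by rewrite !(d_sym z) uv; lia.
  exists m; split=> //.
    by apply: half xmy _ => u xuy; apply: minm; rewrite xuy.
  apply: (half y x) => [|u yux]; first by rewrite !(d_sym y) addnC (d_sym m).
  by apply: minm; rewrite (d_sym x u) (d_sym u y) (d_sym x y) addnC yux.
split=> // x y z w; have [m [xmy xmz ymz]] := med x y z.
(* [m] separates [w] from at least two of [x], [y], [z]. So two of the three sums equal the total of
   the distances to [m], and the third is at most that. *)
have := sep _ _ _ w xmy; have := sep _ _ _ w xmz; have := sep _ _ _ w ymz.
have := d_tri x m w; have := d_tri y m w; have := d_tri z m w.
move: xmy xmz ymz; rewrite /between (d_sym z m) (d_sym y m).
rewrite (d_sym m w); move: (d_sym m w) (d_sym m z) (d_sym m y).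
by move=> ? ? ?; lia.
Qed.

(* In a tree, this says that the paths from [x] to [y] and from [z] to [w] are
   disjoint. *)
Definition separated (T : Type) (d : T -> T -> nat) (x y z w : T) : Prop :=
  d x y + d z w < d x z + d y w /\ d x z + d y w = d x w + d y z.

(** * Disjoint paths and gates in a tree metric *)

Section TreeMetric.

Variables (T : Type) (d : T -> T -> nat).
Hypothesis dP : tree_metric d.

Lemma four_point_sym x y z w :
  [/\ d x y + d z w <= maxn (d x z + d y w) (d x w + d y z),
      d x z + d y w <= maxn (d x y + d z w) (d x w + d y z) &
      d x w + d y z <= maxn (d x y + d z w) (d x z + d y w)].
Proof.
have [_ dC _ fp _] := dP; split; first exact: fp.
  by have := fp x z y w; rewrite (dC z y).
by have := fp x w y z; rewrite (dC w z) (dC w y).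
Qed.

Lemma between_sym x q y : between d x q y -> between d y q x.
Proof. by rewrite /between !(tm_sym dP y) (tm_sym dP q x) addnC. Qed.

(** The two largest of the three sums agree, and the near pairs sum to at most [2k], less than the
    far pairs. *)
Lemma near_far_separated k x y z w :
  d x y <= k -> d z w <= k -> k < d x z -> k < d y w -> separated d x y z w.
Proof. by rewrite /separated; have [] := four_point_sym x y z w; lia. Qed.

(** The path from [x] to [z] stays within the paths from [x] to [y] and from [y] to [z].
    Disjointness thus accumulates along a walk. *)
Lemma separated_trans x y z u v :
  separated d x y u v -> separated d y z u v -> separated d x z u v.
Proof.
case=> xyuv1 xyuv2 [yzuv1 yzuv2].
have [_ xzyu _] := four_point_sym x y z u.
by rewrite /separated; lia.
Qed.

(** The path from [x] to [y] misses [q], so [y] stays on the side of [x], behind [q] as seen from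
    [r]. *)
Lemma between_separated r q s x y :
  between d r q s -> separated d r s x y -> between d r q x -> between d r q y.
Proof.
rewrite /between => rqs [rsxy1 rsxy2] rqx.
have [_ _ qysx] := four_point_sym q s x y.
by have := tm_triangle dP r q y; lia.
Qed.

Lemma between_convex r q x y z :
  between d r q x -> between d r q y -> between d x z y -> between d r q z.
Proof.
rewrite /between (tm_sym dP x z) => rqx rqy xzy.
have [qzxy _ _] := four_point_sym q z x y.
have := tm_triangle dP r z y; have := tm_triangle dP r z x.
by have := tm_triangle dP r q z; lia.
Qed.

(** Here [y] lies on the same side of [q] as [r], and [x] does not. *)
Lemma between_complement r q x y :
  between d r q x -> ~ between d r q y -> between d y q x.
Proof.
have dC := tm_sym dP.
rewrite /between (dC y q) (dC y x) => rqx rqy.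
have [_ rxqy _] := four_point_sym r q x y.
have := tm_triangle dP r q y; have := tm_triangle dP x q y.
by rewrite (dC x q); lia.
Qed.

Lemma separated_between q x y z w :
  separated d x y z w -> between d x q y -> ~ between d z q w.
Proof.
case=> xyzw1 xyzw2 xqy zqw; move: xqy zqw; rewrite /between => xqy zqw.
have := tm_triangle dP x q z; have := tm_triangle dP y q w.
by rewrite (tm_sym dP y q) (tm_sym dP q z); lia.
Qed.

Lemma between_le r m p x z :
  between d r m x -> between d r p x -> d r m <= d r p -> between d r p z ->
  between d r m z.
Proof.
rewrite /between => rmx rpx mp rpz; have [rxmp _ _] := four_point_sym r x m p.
have := tm_triangle dP r m z; have := tm_triangle dP m p z.
by move: rxmp; rewrite !(tm_sym dP x); lia.
Qed.

(* [q] is the point where the path from [r] enters the subtree spanned by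
   [x], [y] and [z]. *)
Lemma gate r x y z : exists q,
  [/\ between d r q x, between d r q y, between d r q z &
      between d x q y \/ between d x q z].
Proof.
have [m [rmx rmy xmy]] := tm_median dP r x y.
have [p [rpx rpz xpz]] := tm_median dP r x z.
have [mp|/ltnW pm] := leqP (d r m) (d r p).
  exists m; split=> //; last by left.
  exact: between_le rmx rpx mp rpz.
exists p; split=> //; last by right.
exact: between_le rpx rmx pm rmy.
Qed.

(** One of [x], [y] is within [k/2] of [q], yet farther than [k] from [r]. *)
Lemma between_far k r q x y :
  between d x q y -> d x y <= k -> k < d r x -> k < d r y -> k.+2 <= (d r q).*2.
Proof.
rewrite /between (tm_sym dP x q).
by have := tm_triangle dP r q x; have := tm_triangle dP r q y; lia.
Qed.

End TreeMetric.

(** * The doubling argument *)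

(** The test [inCp] over plain numbers, so that adjacency becomes linear arithmetic. *)
Definition in_clique (i j l : nat) : bool :=
  [|| (l == 0) && (i <= j),
      (l == 1) && ((j == i) || (j == i.+1)) |
      (l == 2) && (j == i)].

Section Doubling.

Variables (T : Type) (d : T -> T -> nat) (n k : nat) (f : nat -> nat -> T).
Hypothesis dP : tree_metric d.
Hypothesis n_ge3 : 2 < n.
Hypothesis fP : forall i j l l', i < n -> j < n -> l < 4 -> l' < 4 ->
  d (f i l) (f j l') <= k <->
  i = j \/ exists2 m, m.+1 < n & in_clique m i l && in_clique m j l'.

Local Notation a i := (f i 0).
Local Notation b i := (f i 1).
Local Notation c i := (f i 2).
Local Notation dd i := (f i 3).

Let near_same i l l' : i < n -> l < 4 -> l' < 4 -> d (f i l) (f i l') <= k.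
Proof. by move=> *; apply/fP => //; left. Qed.

Let near_clique m i j l l' : i < n -> j < n -> l < 4 -> l' < 4 ->
  m.+1 < n -> in_clique m i l && in_clique m j l' -> d (f i l) (f j l') <= k.
Proof. by move=> *; apply/fP => //; right; exists m. Qed.

Let far i j l l' : i < n -> j < n -> l < 4 -> l' < 4 -> i <> j ->
  (forall m, ~~ (in_clique m i l && in_clique m j l')) ->
  k < d (f i l) (f j l').
Proof.
move=> ? ? ? ? nij nm; rewrite ltnNge; apply/negP => /fP[] // [m _].
by rewrite (negPf (nm m)).
Qed.

Ltac solve_far := apply: far; try (move=> m; rewrite /in_clique); lia.
Ltac solve_near m := apply: (@near_clique m); rewrite /in_clique; lia.

Let near_a i j : i < n -> j < n -> d (a i) (a j) <= k.
Proof. by move=> ? ?; solve_near 0. Qed.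

Definition is_gate j q :=
  [/\ between d (a 0) q (c j), between d (a 0) q (dd j),
      between d (a 0) q (b j.+1) &
      between d (c j) q (dd j) \/ between d (c j) q (b j.+1)].

Lemma gate_far j q : 0 < j -> j.+1 < n -> is_gate j q ->
  k.+2 <= (d (a j.-1) q).*2.
Proof.
move=> j0 jn [_ _ _ []] bq; apply: (between_far dP bq).
- by apply: near_same; lia.
- by solve_far.
- by solve_far.
- by solve_near j.
- by solve_far.
- by solve_far.
Qed.

(* The walk a_0, a_{j-1}, b_j, d_j, c_j replaces the non-adjacent pair (a_0, c_j). *)
Lemma path_separated j i l i' l' : 0 < j -> j.+1 < n ->
  d (f i l) (f i' l') <= k ->
  k < d (a 0) (f i l) -> k < d (a j.-1) (f i l) -> k < d (a j.-1) (f i' l') ->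
  k < d (b j) (f i' l') -> k < d (dd j) (f i l) -> k < d (c j) (f i' l') ->
  separated d (a 0) (c j) (f i l) (f i' l').
Proof.
move=> j0 jn ii' a0i ai ai' bi' di ci'.
apply: (@separated_trans _ _ dP _ (a j.-1)).
  by apply: (near_far_separated dP (k := k)) => //; apply: near_a; lia.
apply: (@separated_trans _ _ dP _ (b j)).
  by apply: (near_far_separated dP (k := k)) => //; solve_near j.-1.
apply: (@separated_trans _ _ dP _ (dd j)); last first.
  by apply: (near_far_separated dP (k := k)) => //; apply: near_same; lia.
(* The ends are swapped because [b j] is assumed far from [f i' l'] only: [f i l] may be [b j.+1],
   which is adjacent to [b j]. *)
have := near_far_separated dP (k := k) (x := dd j) (y := b j).
move/(_ (f i l) (f i' l')); rewrite /separated (tm_sym dP _ (b j)).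
have -> : d (b j) (dd j) <= k by apply: near_same; lia.
by move/(_ isT ii' di bi'); lia.
Qed.

(** Starting at [b j.+1], which is behind [q], these vertices are reached through adjacent pairs
    whose tree paths miss the path from [a 0] to [c j]. They span the subtree of the next gate. *)
Lemma right_of_gate j q : 0 < j -> j.+1 < n -> is_gate j q ->
  [/\ between d (a 0) q (dd j.+1), between d (a 0) q (c j.+1) &
      j.+2 < n -> between d (a 0) q (b j.+2)].
Proof.
move=> j0 jn [rc rd rb _].
have bd : between d (a 0) q (dd j.+1).
  apply: (between_separated dP rc _ rb); apply: path_separated => //;
    by [apply: near_same; lia | solve_far].
split=> //.
  apply: (between_separated dP rc _ bd); apply: path_separated => //;
    by [apply: near_same; lia | solve_far].
move=> jn2; apply: (between_separated dP rc _ rb); apply: path_separated => //;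
  by [solve_near j.+1 | solve_far].
Qed.

Lemma gate_reach j q : 0 < j -> j.+1 < n -> is_gate j q ->
  d (a 0) q + d q (a j) <= k.
Proof.
move=> j0 jn gq; have [rc rd rb _] := gq; have [rd1 _ _] := right_of_gate j0 jn gq.
have [aj|/eqP naj] := eqVneq (d (a 0) q + d q (a j)) (d (a 0) (a j)).
  by rewrite aj; apply: near_a; lia.
have ad : between d (a j) q (dd j) := between_complement dP rd naj.
(* If [q] did not separate [a 0] from [a j.+1] either, these two disjoint paths would both contain
   [q]. *)
have sep : separated d (a j) (dd j) (dd j.+1) (a j.+1).
  apply: (near_far_separated dP (k := k));
    by [apply: near_same; lia | solve_far].
have [am|/eqP nam] := eqVneq (d (a 0) q + d q (a j.+1)) (d (a 0) (a j.+1)).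
  have : d (a 0) (a j.+1) <= k by apply: near_a; lia.
  have : k < d (dd j) (a j.+1) by solve_far.
  have : d (a j) (dd j) <= k by apply: near_same; lia.
  have := tm_triangle dP (dd j) q (a j.+1).
  move: ad; rewrite /between (tm_sym dP (a j) q) (tm_sym dP (dd j) q).
  by lia.
have ad1 : between d (a j.+1) q (dd j.+1) := between_complement dP rd1 nam.
by case: (separated_between dP sep ad (between_sym dP ad1)).
Qed.

Lemma gate_exists j : exists q, is_gate j q.
Proof. exact: gate. Qed.

(** The recurrence for the excess starts at [x_1 >= 2], whence [x_j >= 2^(j+1) - 2]; the terms are
    arranged to avoid truncated subtraction. *)
Lemma gate_doubling j q : 0 < j -> j.+1 < n -> is_gate j q ->
  2 ^ j.+1 + k <= (d (a 0) q).*2 + 2.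
Proof.
elim: j q => // -[_ q _ n2 /gate_far|j IH q _ jn gq].
  by move=> /(_ isT n2); rewrite /=; lia.
have [p gp] := gate_exists j.+1; have jn' : j.+2 < n by lia.
have := IH p isT jn' gp; have := gate_reach (ltn0Sn _) jn' gp; have := gate_far (ltn0Sn _) jn gq.
have [pd pc pb] := right_of_gate (ltn0Sn _) jn' gp.
(* [q] lies on a path between two vertices behind [p]. *)
have pq : between d (a 0) p q.
  have [_ _ _ [] cq] := gq; first exact: (between_convex dP pc pd cq).
  by apply: (between_convex dP pc (pb _) cq); lia.
have := tm_triangle dP (a j.+1) p q; rewrite (tm_sym dP _ p) /=.
by move: pq; rewrite /between (expnS _ j.+2); lia.
Qed.

Lemma threshold_ge : 2 ^ (n - 2) <= k.
Proof.
(* This is the last index [j] for which [b j.+1] is a vertex. *)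
have [q gq] := gate_exists n.-2.
have n0 : 0 < n.-2 by lia.
have n1 : n.-2.+1 < n by lia.
have := gate_doubling n0 n1 gq; have := gate_reach n0 n1 gq.
have -> : n - 2 = n.-2 by lia.
(* The gate bounds give [k >= 2^(n-1) - 2]; the lost 2 is at most half of the power. *)
have : 2 <= 2 ^ n.-2 by rewrite -{1}(expn1 2) leq_exp2l.
by rewrite expnS; lia.
Qed.

End Doubling.

(** * Transfer to the graphs [R_n] *)

Theorem theorem2 (n : nat) : 3 <= n ->
  forall k : nat, 0 < k -> k_leaf_power (@R_adj n) k -> 2 ^ (n - 2) <= k.
Proof.
case: n => // n n2 k _ [T [e [tau [tree_e _ _ _ adjP]]]].
have [d dP distP] := tree_distance tree_e.
pose vertex i l : 'I_n.+1 * 'I_4 := (inord i, inord l).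
apply: (@threshold_ge _ d _ _ (fun i l => tau (vertex i l))) => //.
move=> i j l l' ilt jlt llt l'lt.
have vi (m i' l0 : nat) : i' < n.+1 -> l0 < 4 ->
    inCp m (vertex i' l0) = in_clique m i' l0.
  by move=> ? ?; rewrite /inCp /= !inordK.
(* [adjP] covers distinct vertices only; equal ones have distance 0 and satisfy [i = j]. *)
have [uv|uv] := eqVneq (vertex i l) (vertex j l').
  rewrite uv (tm_refl dP); split=> // _; left.
  by case: uv => /(congr1 val) /=; rewrite !inordK.
apply: (iff_trans (iff_sym (distP _ _ _))).
apply: (iff_trans (iff_sym (adjP _ _ uv))).
rewrite /R_adj uv /=; split=> [/orP[/eqP ij|/existsP[m /and3P[mn]]]|].
- by left; move/(congr1 val): ij; rewrite /= !inordK.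
- by rewrite !vi // => mi mj; right; exists m; rewrite ?mi ?mj //; lia.
case=> [->|[m mn /andP[mi mj]]]; first by rewrite eqxx.
have mlt : m < n.+1 by lia.
apply/orP; right; apply/existsP; exists (Ordinal mlt).
by rewrite !vi //= mi mj; lia.
Qed.
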